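(* Let $\kappa$ be an infinite cardinal, $X\subseteq{}^\kappa\kappa$ with the subspace topology, and $\alpha<\kappa^+$. For $A\subseteq X$, $A\in\boldsymbol\Pi^0_\alpha(X)$ if and only if $A=B(\mathrm{Tr},\ell)$ for some $\kappa^+$-Borel code $(\mathrm{Tr},\ell)$ with $\varrho(\mathrm{Tr})\le\alpha+1$.
   Context: ${}^\kappa\kappa$ has the bounded topology generated by $N_p=\{x:p\subseteq x\}$, $p\in{}^{<\kappa}\kappa$. $\boldsymbol\Sigma^0_1(X)$ = open subsets of $X$, $\boldsymbol\Pi^0_1(X)$ = closed; for $\alpha\ge2$, $\boldsymbol\Sigma^0_\alpha(X)$ = unions of $\kappa$-many sets in $\bigcup_{1\le\beta<\alpha}\boldsymbol\Pi^0_\beta(X)$, $\boldsymbol\Pi^0_\alpha(X)$ = their complements; by convention $\boldsymbol\Pi^0_0(X)=\boldsymbol\Sigma^0_0(X)$ = the clopen subsets of $X$. Trees: nonempty partial order with a unique minimal element (root), predecessors of each node forming a finite linear order; well-founded = no infinite chain; leaves have rank $0$, non-leaf $p$ has rank $\sup\{\varrho(q)+1:p<q\}$; $\varrho(\mathrm{Tr})$ = rank of root $+1$. A $\kappa^+$-Borel code is a pair $(\mathrm{Tr},\ell)$ with $\mathrm{Tr}$ a well-founded tree of size $\le\kappa$ and $\ell$ a function sending leaves of $\mathrm{Tr}$ to clopen subsets of $X$. For $x\in X$, the game $G(\mathrm{Tr},\ell,x)$: player I first picks an immediate successor of the root, then II and I alternately pick an immediate successor of the opponent's last move, until a leaf $p$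 is reached (if the root is a leaf, the game ends immediately with $p$ the root); II wins iff $x\in\ell(p)$. $B(\mathrm{Tr},\ell)=\{x\in X:$ II has a winning strategy in $G(\mathrm{Tr},\ell,x)\}$. *)

(* Defs.v *)
From HB Require Import structures.
From mathcomp Require Import all_boot all_order.
From mathcomp Require Import all_classical topology wochoice.

Set Implicit Arguments.
Unset Strict Implicit.
Unset Printing Implicit Defensive.

Import Order.TTheory.
Local Open Scope classical_set_scope.
Local Open Scope card_scope.
Local Open Scope order_scope.

(* [osup I f] denotes the least ordinal strictly above all the [f i], that is
   sup {f i + 1 : i in I}. Distinct terms may denote the same ordinal, so
   equality of ordinals is [oeq], not Leibniz equality. *)
Inductive ord : Type := osup (I : Type) of I -> ord.

Fixpoint ole (a b : ord) {struct a} : Prop :=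
  match a, b with osup D f, osup E g => forall i, exists j, ole (f i) (g j) end.

Definition olt (a b : ord) : Prop :=
  match b with osup E g => exists j, ole a (g j) end.

Definition oeq (a b : ord) : Prop := ole a b /\ ole b a.

Definition ozero : ord := osup (fun e : False => match e with end).
Definition osucc (a : ord) : ord := osup (fun _ : unit => a).
Definition oone : ord := osucc ozero.
Definition otwo : ord := osucc oone.

Lemma oleE I (f : I -> ord) b : ole (osup f) b <-> forall i, olt (f i) b.
Proof. by case: b. Qed.

Lemma ole_refl a : ole a a.
Proof. by elim: a => I f IH /= i; exists i. Qed.

Lemma ole_trans a b c : ole a b -> ole b c -> ole a c.
Proof.
elim: a b c => I f IH [J g] [L h] /= fg gh i.
by have [j /IH fgj] := fg i; have [l /fgj] := gh j; exists l.
Qed.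

Lemma ole_lt_trans a b c : ole a b -> olt b c -> olt a c.
Proof. by case: c => L h ab [l bl]; exists l; exact: ole_trans bl. Qed.

Lemma olt_le_trans a b c : olt a b -> ole b c -> olt a c.
Proof.
case: b => J g [j aj] /oleE/(_ j); exact: ole_lt_trans.
Qed.

Lemma ole_osup I (f : I -> ord) i : olt (f i) (osup f).
Proof. by exists i; exact: ole_refl. Qed.

Lemma oltW a b : olt a b -> ole a b.
Proof.
elim: a b => I f IH [J g] [j fj]; apply/oleE => i.
exists j; apply: IH; exact: olt_le_trans (ole_osup f i) fj.
Qed.

Lemma olt_succ a b : olt a b <-> ole (osucc a) b.
Proof. by rewrite oleE; split=> [? _//|/(_ tt)]. Qed.

Lemma olt_wf : well_founded olt.
Proof.
suff H b a : ole a b -> Acc olt a by move=> a; apply: (H a); exact: ole_refl.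
elim: b a => J g IH a ab; constructor => c ca.
by have [j] := olt_le_trans ca ab; exact: IH.
Qed.

Lemma ole_total a b : ole a b \/ olt b a.
Proof.
elim: a b => I f IH b; have [ab|] := pselect (ole (osup f) b); first by left.
move/oleE/existsNP => [i nfb]; right; exists i.
elim: b nfb => J g IHb nfb; apply/oleE => j.
have [fg|//] := IH i (g j).
by case: nfb; exists j.
Qed.

(* [K], with its order, is the initial ordinal kappa *)
Definition infinite_cardinal d (K : orderType d) : Prop :=
  [/\ well_order (<=%O : rel K),
      infinite_set [set: K] &
      forall k : K, ~ ([set: K] #<= [set j : K | j < k])].

(* alpha < kappa^+ amounts to |alpha| <= kappa; here [e] lists, up to [oeq], all the
   elements of alpha *)
Definition below_succ_card (K : Type) (a : ord) : Prop :=
  exists e : K -> ord, forall b, olt b a -> exists k, oeq b (e k).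

Definition bspace d (K : orderType d) := K -> K.
HB.instance Definition _ d (K : orderType d) := Choice.on (bspace K).

(* N_p for p : gamma -> K, where gamma < kappa is identified with an element
   of K and its set of predecessors *)
Definition cone d (K : orderType d) (gamma : K)
    (p : {i : K | i < gamma} -> K) : set (bspace K) :=
  [set x | forall i, x (sval i) = p i].

HB.instance Definition _ d (K : orderType d) :=
  @isSubBaseTopological.Build (bspace K) (set (bspace K))
    [set N | exists gamma, exists p, N = @cone d K gamma p] id.

Inductive Sigma0 (K : Type) (X : topologicalType) : ord -> set X -> Prop :=
| Sigma0_clopen a A : oeq a ozero -> clopen A -> Sigma0 K a A
| Sigma0_open a A : oeq a oone -> open A -> Sigma0 K a A
| Sigma0_bigcup a (b : K -> ord) (F : K -> set X) :
    ole otwo a -> (forall k, ole oone (b k)) -> (forall k, olt (b k) a) ->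
    (forall k, Pi0 K (b k) (F k)) -> Sigma0 K a (\bigcup_k F k)
with Pi0 (K : Type) (X : topologicalType) : ord -> set X -> Prop :=
| Pi0_setC a A : Sigma0 K a (~` A) -> Pi0 K a A.

Record tree : Type := Tree {
  disp : Order.disp_t;
  node :> porderType disp;
  root : node;
  root_minimal : forall p : node, ~ p < root;
  root_unique : forall m : node, (forall p : node, ~ p < m) -> m = root;
  preds_finite : forall p : node, finite_set [set q : node | q < p];
  preds_linear : forall p : node,
    total_on [set q : node | q < p] (fun q r => q <= r)
}.

Definition wf_tree (T : tree) : Prop :=
  ~ exists C : set T, infinite_set C /\ total_on C (fun p q => p <= q).

Definition leaf (T : tree) (p : T) : Prop := ~ exists q : T, p < q.

Definition immediate_succ (T : tree) (p q : T) : Prop :=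
  p < q /\ ~ exists r : T, p < r /\ r < q.

Lemma wf_tree_gt (T : tree) :
  wf_tree T -> well_founded (fun q p : T => p < q).
Proof.
move=> wfT p; apply: contrapT => nAp; apply: wfT.
pose bad := {q : T | ~ Acc (fun q p : T => p < q) q}.
have next (q : bad) : {r : bad | sval q < sval r}.
  apply: cid; apply: contrapT => nex; case: q nex => q nq /= nex.
  apply: nq; constructor => r qr; apply: contrapT => nr.
  by apply: nex; exists (exist _ r nr).
pose s n : T := sval (iter n (fun q => sval (next q)) (exist _ p nAp)).
have sS n : s n < s n.+1 by exact: (svalP (next _)).
have slt m n : (m < n)%N -> s m < s n.
  elim: n => // n IH; rewrite ltnS leq_eqVlt => /orP[/eqP->//|/IH h].
  exact: lt_trans h (sS n).
have s_inj : injective s.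
  by move=> m n e; case: (ltngtP m n) => // /slt; rewrite e ltxx.
exists (range s); split.
  apply/infiniteP; have /card_eqPle[_ //] : range s #= [set: nat].
  by apply: inj_card_eq => m n _ _; exact: s_inj.
move=> _ _ [m _ <-] [n _ <-].
by case: (ltngtP m n) => [/slt/ltW|/slt/ltW|->]; [left|right|left].
Qed.

(* rank p = sup {rank q + 1 : p < q}; in particular a leaf has rank 0 *)
Definition rank (T : tree) (wfT : wf_tree T) : T -> ord :=
  Fix (wf_tree_gt wfT) (fun=> ord)
    (fun p rk => osup (fun q : {q : T | p < q} => rk (sval q) (svalP q))).

Lemma rankE (T : tree) (wfT : wf_tree T) (p : T) :
  rank wfT p = osup (fun q : {q : T | p < q} => rank wfT (sval q)).
Proof.
rewrite /rank Fix_eq// => q f g fg; congr osup.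
by apply/funext => r; exact: fg.
Qed.

Definition tree_rank (T : tree) (wfT : wf_tree T) : ord :=
  osucc (rank wfT (root T)).

Record borel_code (K : Type) (X : topologicalType) : Type := BorelCode {
  code_tree :> tree;
  code_wf : wf_tree code_tree;
  code_card : [set: code_tree] #<= [set: K];
  (* only the values of [label] at leaves matter *)
  label : code_tree -> set X;
  label_clopen : forall p, leaf p -> clopen (label p)
}.

Arguments code_wf {K X} b.

Section game.
Context (K : Type) (X : topologicalType) (c : borel_code K X) (x : X).
Implicit Types (s : seq c) (sigma : seq c -> c).

(* A position is the list [s] of the moves made so far, oldest first, so the
   moves of player II are those with an odd index and II is to move when
   [size s] is odd; [last (root c) s] is the node reached. *)
Definition position s : Prop :=
  path (fun p q => `[< immediate_succ p q >]) (root c) s.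

Definition follows sigma s : Prop :=
  forall i, (i < size s)%N -> odd i -> nth (root c) s i = sigma (take i s).

Definition winning_strategy sigma : Prop :=
  forall s, position s -> follows sigma s ->
    let p := last (root c) s in
    (leaf p -> label p x) /\
    (odd (size s) -> ~ leaf p -> immediate_succ p (sigma s)).

End game.

Definition borel_set (K : Type) (X : topologicalType) (c : borel_code K X) :
    set X :=
  [set x | exists sigma, @winning_strategy K X c x sigma].

(* Main.v *)
(** Unravelling the game, the set of points won by II from a node is an
    intersection (I to move) or a union (II to move) of the sets attached to the
    immediate successors, so induction on the rank puts it in Pi_rank or
    Sigma_rank. This uses that open sets are unions of kappa many clopen sets:
    [U] is the union over [gamma] of the sets of those [x] all of whose
    extensions of [x | gamma] lie in [U], and such a set only depends on
    [x | gamma].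

    Conversely, a Sigma_alpha set is a kappa-union of complements of sets of
    smaller Sigma-class; exchanging the players complements the labels, so codes
    for the pieces can be glued below a new root. Nodes are then finite sequences
    in kappa, and there are only kappa many of these because kappa * kappa = kappa. *)
From HB Require Import structures.
From mathcomp Require Import all_boot all_order finmap.
From mathcomp Require Import all_classical topology.
(* [Defs] comes last so that [root] is the root of a tree and not [fingraph.root]. *)
Require Import Defs.

Set Implicit Arguments.
Unset Strict Implicit.
Unset Printing Implicit Defensive.

Import Order.TTheory.
(* In the other order, [~` A] would be parsed as [Order.compl A]. *)
Local Open Scope order_scope.
Local Open Scope classical_set_scope.
Local Open Scope card_scope.

(** * Cardinal arithmetic *)

Lemma card_le_injP T (U : pointedType) (A : set T) (B : set U) :
  A #<= B <-> exists2 f : T -> U, set_fun A B f & set_inj A f.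
Proof. by rewrite -injfunPex; split=> /pcard_leP. Qed.

Lemma card_le_rel T U (G : T -> U -> Prop) (A : set T) (B : set U) :
    (forall a, A a -> exists2 b, B b & G a b) ->
    (forall a a' b, G a b -> G a' b -> a = a') ->
  A #<= B.
Proof.
move=> total inj; apply/card_leP/injfunPex.
have /choice[f Gf] (a : A) : exists b : B, G (val a) (val b).
  have [b Bb Gab] := total _ (set_mem (valP a)).
  by exists (SigSub (mem_set Bb)).
exists f => // a a' _ _ faa'; apply: val_inj.
by apply: (inj _ _ _ (Gf a)); rewrite faa'; exact: Gf.
Qed.

(** Zorn's lemma gives a maximal graph of a partial injection from [A] to [B]. If it missed a point
    on each side, the pair of these two points could be added. *)
Lemma card_le_total T U (A : set T) (B : set U) : (A #<= B) \/ (B #<= A).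
Proof.
(* The equivalence states functionality and injectivity of [G] at once. *)
pose P (G : set (T * U)) := (G `<=` A `*` B) /\
  forall p q, G p -> G q -> p.1 = q.1 <-> p.2 = q.2.
have [F FP Ftot|G [[GAB Ginj] Gmax]] := @Zorn_bigcup _ P.
  split=> [p [X /FP[XAB _]]|p q [X FX Xp] [Y FY Yq]]; first exact: XAB.
  have [XY|YX] := Ftot _ _ FX FY.
  - by apply: (FP _ FY).2 => //; exact: XY.
  - by apply: (FP _ FX).2 => //; exact: YX.
have [domG|/existsNP[a0 /not_implyP[Aa0 nGa]]] :=
    pselect (forall a, A a -> exists2 b, B b & G (a, b)).
  left; apply: card_le_rel domG _ => a a' b Gab Ga'b.
  exact/(Ginj _ _ Gab Ga'b).
have [codG|/existsNP[b0 /not_implyP[Bb0 nGb]]] :=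
    pselect (forall b, B b -> exists2 a, A a & G (a, b)).
  right; apply: card_le_rel codG _ => b b' a Gab Gab'.
  exact/(Ginj _ _ Gab Gab').
have nGa' p : G p -> p.1 <> a0.
  case: p => a' b' Gp /= e; rewrite e in Gp.
  by apply: nGa; exists b' => //; exact: (GAB _ Gp).2.
have nGb' p : G p -> p.2 <> b0.
  case: p => a' b' Gp /= e; rewrite e in Gp.
  by apply: nGb; exists a' => //; exact: (GAB _ Gp).1.
case: (Gmax (G `|` [set (a0, b0)])).
  split; first by move=> ?; left.
  by move=> /(_ (a0, b0)) /= => /(_ (or_intror erefl)) /nGa'.
split=> [p [/GAB//|->//]|p q [Gp|->] [Gq|->]] //=; first exact: Ginj.
- by split=> e; [case: (nGa' _ Gp)|case: (nGb' _ Gp)].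
- by split=> e; [case: (nGa' _ Gq)|case: (nGb' _ Gq)].
Qed.

Lemma card_le_setX T1 T2 (U1 U2 : pointedType) (A1 : set T1) (A2 : set T2)
    (B1 : set U1) (B2 : set U2) :
  A1 #<= B1 -> A2 #<= B2 -> A1 `*` A2 #<= B1 `*` B2.
Proof.
move=> /card_le_injP[f fAB finj] /card_le_injP[g gAB ginj].
apply/card_le_injP; exists (fun p => (f p.1, g p.2)).
  by move=> p [/fAB + /gAB]; split.
move=> [a b] [a' b'] /set_mem[/= Aa Ab] /set_mem[/= Aa' Ab'] [faa' gbb'].
by congr pair; [apply: finj|apply: ginj]; rewrite ?inE.
Qed.

(** Two copies of [B], tagged by distinct points [i 0] and [i 1] of [B], fit in the square of [B]:
    one receives [A], the other the rest of [B]. *)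
Lemma infinite_card_le_setU (T : pointedType) (A B : set T) :
  infinite_set B -> B `*` B #<= B -> A #<= B -> A `|` B #<= B.
Proof.
move=> /infiniteP/card_le_injP[i iB iinj] BB /card_le_injP[f fAB finj].
apply: card_le_trans BB; apply/card_le_injP.
exists (fun x => if x \in A then (i 0%N, f x) else (i 1%N, x)).
  by move=> x /=; case: ifPn => [/set_mem Ax _|/negP xA [/mem_set//|Bx]];
     split=> /=; try exact: iB; rewrite //; exact: fAB.
have i01 : i 0%N <> i 1%N by move=> /iinj; rewrite !inE => /(_ I I).
move=> x y _ _ /=; case: ifP => xA; case: ifP => yA.
- by move=> [/finj]; rewrite xA yA; exact.
- by move=> [].
- by move=> [/esym].
- by move=> [].
Qed.

(* [square_inj G]: [G] is the graph of an injection [A `*` A -> A], where [A] is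
   [square_dom G]. A maximal such [A] has full cardinality. *)
Section hessenberg.
Context (T : pointedType).
Implicit Types G F : set (T * T * T).

Definition square_dom G := [set a | exists b c, G (a, b, c)].

Definition square_inj G :=
  [/\ forall a b c, G (a, b, c) -> [/\ square_dom G a, square_dom G b & square_dom G c],
      forall p q, G p -> G q -> p.1 = q.1 <-> p.2 = q.2 &
      forall a b, square_dom G a -> square_dom G b -> exists c, G (a, b, c)].

Lemma square_inj_card G : square_inj G ->
  square_dom G `*` square_dom G #<= square_dom G.
Proof.
move=> [dom inj total].
apply: (@card_le_rel _ _ (fun p c => G (p.1, p.2, c))) => [[a b] [/= Aa Ab]|].
  by have [c Gc] := total a b Aa Ab; exists c => //; have [] := dom _ _ _ Gc.
move=> [a b] [a' b'] c /= Gp Gq; exact/(inj _ _ Gp Gq).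
Qed.

(** The pairs outside the square of [square_dom G] are sent into [B], which is disjoint from
    [square_dom G], so new values never collide with old ones. A point of [B] makes the extension
    proper. *)
Lemma square_inj_extend G (B : set T) : square_inj G ->
    (forall x, square_dom G x -> ~ B x) -> B !=set0 ->
    (square_dom G `|` B) `*` (square_dom G `|` B) #<= B ->
  exists2 G', G `<` G' & square_inj G'.
Proof.
set A := square_dom G => -[dom inj total] AB [b0 Bb0] /card_le_injP[h hB hinj].
pose N := [set p : T * T * T |
  [/\ (A `|` B) p.1.1, (A `|` B) p.1.2, ~ (A p.1.1 /\ A p.1.2) & p.2 = h p.1]].
have domN a : (A `|` B) a -> square_dom (G `|` N) a.
  move=> ABa; exists b0, (h (a, b0)); right; split=> //=; first by right.
  by move=> [_ /AB].
have dom' a : square_dom (G `|` N) a -> (A `|` B) a.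
  by move=> [b [c [Gp|[]//]]]; left; exists b, c.
have NB p : N p -> B p.2 by case: p => [[a b] c] [/= ? ? ? ->]; exact: hB.
have mix p q : G p -> N q -> p.1 <> q.1 /\ p.2 <> q.2.
  case: p q => [[a b] c] [[a' b'] c'] Gp Nq; have [Aa Ab Ac] := dom _ _ _ Gp.
  split=> /= e; last by move: (NB _ Nq) => /=; rewrite -e; exact: AB.
  by case: Nq => /= _ _ + _; case: e => <- <-; apply.
exists (G `|` N).
  split=> [|/(_ (b0, b0, h (b0, b0)))]; first by move=> ?; left.
  have Nb0 : N (b0, b0, h (b0, b0)) by split=> /=; [right|right|case=> /AB|].
  by move=> /(_ (or_intror Nb0)) /mix - /(_ _ Nb0)[].
split.
- move=> a b c [Gp|Np].
    by have [Aa Ab Ac] := dom _ _ _ Gp; split; apply: domN; left.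
  by case: (Np) => /= *; split; apply: domN => //; right; exact: (NB _ Np).
- move=> p q [Gp|Np] [Gq|Nq]; first exact: inj.
  + by have [] := mix _ _ Gp Nq.
  + by have [n1 n2] := mix _ _ Gq Np; split=> /esym.
  + case: Np Nq => [pa pb _ ->] [qa qb _ ->]; split=> [->//|].
    by apply: hinj; rewrite inE.
- move=> a b /dom' ABa /dom' ABb; have [[Aa Ab]|nA] := pselect (A a /\ A b).
    by have [c Gc] := total _ _ Aa Ab; exists c; left.
  by exists (h (a, b)); right; split.
Qed.

Lemma square_inj_bigcup (C : set (set (T * T * T))) :
  C `<=` square_inj -> total_on C subset -> square_inj (\bigcup_(X in C) X).
Proof.
move=> Cinj Ctot.
have sub X a : C X -> square_dom X a -> square_dom (\bigcup_(X in C) X) a.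
  by move=> CX [b [c Xp]]; exists b, c; exists X.
split.
- move=> a b c [X CX /(let: And3 dom _ _ := Cinj _ CX in dom)[? ? ?]].
  by split; exact: sub CX _.
- move=> p q [X CX Xp] [Y CY Yq]; have [XY|YX] := Ctot _ _ CX CY.
  + by have [_ inj _] := Cinj _ CY; apply: inj => //; exact: XY.
  + by have [_ inj _] := Cinj _ CX; apply: inj => //; exact: YX.
- move=> a b [a1 [a2 [X CX Xa]]] [b1 [b2 [Y CY Yb]]].
  have [XY|YX] := Ctot _ _ CX CY.
  + have [_ _ total] := Cinj _ CY.
    have [||c] := total a b; [by exists a1, a2; exact: XY|by exists b1, b2|].
    by exists c; exists Y.
  + have [_ _ total] := Cinj _ CX.
    have [||c] := total a b; [by exists a1, a2|by exists b1, b2; exact: YX|].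
    by exists c; exists X.
Qed.

(** Let [A] be the domain of a maximal [G]. By [noext], no infinite [B] outside [A] that absorbs its
    own square can dominate [A]. Were [A] finite, a countable [B] would do; were [A] dominated by
    its complement, a copy of [A] there would do. Hence the complement embeds in [A], and so does
    all of [T]. *)
Lemma infinite_card_square : infinite_set [set: T] ->
  [set: T] `*` [set: T] #<= [set: T].
Proof.
move=> Tinf; have [G [Ginj Gmax]] := Zorn_bigcup square_inj_bigcup.
set A := square_dom G.
have AA : A `*` A #<= A by exact: square_inj_card.
have noext B : B `<=` ~` A -> infinite_set B -> B `*` B #<= B -> ~ (A #<= B).
  move=> BA Binf BB AB; have ABB := infinite_card_le_setU Binf BB AB.
  have [|||G' GG' G'inj] := square_inj_extend Ginj (B := B).
  - by move=> x Ax /BA.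
  - exact: infinite_setN0.
  - exact: card_le_trans (card_le_setX ABB ABB) BB.
  - exact: Gmax G'inj.
have transport (U : pointedType) (B : set T) (C : set U) :
    B #= C -> C `*` C #<= C -> B `*` B #<= B.
  move=> /card_eqPle[BC CB] CC.
  exact: card_le_trans (card_le_setX BC BC) (card_le_trans CC CB).
have Ainf : infinite_set A.
  move=> Afin; have /infiniteP/card_subP[B Bnat BA] := infinite_setD Tinf Afin.
  have Binf : infinite_set B by apply/infiniteP; move: Bnat => /card_eqPle[].
  apply: (noext B) => //.
  - by move=> x /BA[].
  - apply: transport Bnat _; rewrite setXTT.
    by have /card_eqPle[] := card_nat2.
  - apply: card_le_trans (finite_set_countable Afin) _.
    by move: Bnat => /card_eqPle[].
have [/card_subP[B BA sB]|AcA] := card_le_total A (~` A).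
  case: (noext B) => //; last by move: BA => /card_eqPle[].
  - by move: BA => /card_eqPle[_ AB] /(card_le_finite AB).
  - exact: transport BA AA.
have TA : [set: T] #<= A by rewrite -(setvU A); exact: infinite_card_le_setU.
exact: card_le_trans (card_le_setX TA TA) (card_le_trans AA (card_leT _)).
Qed.

Lemma infinite_card_seq : infinite_set [set: T] -> [set: seq T] #<= [set: T].
Proof.
move=> Tinf.
have /card_le_injP[p _ pinj] := infinite_card_square Tinf.
have /infiniteP/card_le_injP[i _ iinj] := Tinf.
have {}pinj a b a' b' : p (a, b) = p (a', b') -> a = a' /\ b = b'.
  by move=> e; have [] : (a, b) = (a', b') by apply: pinj; rewrite ?inE.
pose code := foldr (fun x y => p (x, y)) point.
(* The length is recorded because iterated pairing alone does not determine it. *)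
apply/card_le_injP; exists (fun s => p (i (size s), code s)) => // s t _ _.
move=> /pinj[/iinj]; rewrite !inE => /(_ I I).
elim: s t => [|x s IH] [|y t] //= [st] /pinj[-> e].
by rewrite (IH t).
Qed.

End hessenberg.

(** * The bounded topology *)

Section bounded_topology.
Context d (K : orderType d).
Implicit Types (x y : bspace K) (gamma : K).

Definition agree gamma x y := forall i, i < gamma -> x i = y i.

Lemma agree_sym gamma x y : agree gamma x y -> agree gamma y x.
Proof. by move=> xy i /xy. Qed.

Lemma agree_trans gamma x y z : agree gamma x y -> agree gamma y z -> agree gamma x z.
Proof. by move=> xy yz i ig; rewrite xy// yz. Qed.

Lemma open_agree gamma x : open (agree gamma x : set (bspace K)).
Proof.
have coneE : agree gamma x = cone (fun i : {i : K | i < gamma} => x (sval i)).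
  apply/seteqP; split=> y xy; first by case=> i ig /=; rewrite xy.
  by move=> i ig; rewrite (xy (exist _ i ig)).
exists [set agree gamma x]; last by rewrite bigcup_set1.
move=> _ ->; exists [fset (agree gamma x : set (bspace K))]%fset.
  by move=> N /fset1P ->; rewrite inE; exists gamma; eexists; exact: coneE.
by apply/seteqP; split=> [y /(_ (agree gamma x)) /= |y xy N /fset1P -> //]; rewrite inE; exact.
Qed.

(** A basic neighbourhood of [x] is a finite intersection of cones; the maximum of their lengths
    works, with [k0] serving for the empty intersection. *)
Lemma agree_open (k0 : K) (U : set (bspace K)) x : open U -> U x ->
  exists gamma, agree gamma x `<=` U.
Proof.
move=> [F Fbase <-] [V FV Vx]; have [D Dcone VE] := Fbase _ FV.
suff [gamma xV] : exists gamma, agree gamma x `<=` V.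
  by exists gamma => y /xV Vy; exists V.
rewrite -VE in Vx *.
suff [gamma xD] : exists gamma, forall N : set (bspace K), N \in (D : seq _) -> agree gamma x `<=` N.
  by exists gamma => y xy N /= ND; exact: xD xy.
have {Dcone Vx VE FV} : forall N : set (bspace K), N \in (D : seq _) ->
    N x /\ exists gamma p, N = @cone d K gamma p.
  by move=> N ND; split; [exact: Vx|exact/set_mem/Dcone].
elim: (D : seq (set (bspace K))) => [|N s IH] Ns; first by exists k0.
have [|gamma xs] := IH; first by move=> M Ms; apply: Ns; rewrite inE Ms orbT.
have [Nx [delta [p NE]]] := Ns N (mem_head _ _).
exists (Order.max gamma delta) => M; rewrite inE => /orP[/eqP->|/xs gM].
  rewrite NE => y xy i; rewrite -xy ?lt_max ?(svalP i) ?orbT//.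
  by move: Nx; rewrite NE; exact.
by move=> y xy; apply: gM => i ig; apply: xy; rewrite lt_max ig.
Qed.

Variable X : set (bspace K).

Lemma open_agree_closed gamma (V : set X) :
  (forall x y : X, agree gamma (val x) (val y) -> V x -> V y) -> open V.
Proof.
move=> Vagree.
exists (\bigcup_(x in V) (agree gamma (val x) : set (bspace K))).
  by apply: bigcup_open => x _; exact: open_agree.
apply/seteqP; split=> [y [x Vx xy]|x Vx]; first exact: Vagree xy Vx.
by exists x.
Qed.

(** Since [agree] is symmetric, the complement of [V] is closed under agreement too. *)
Lemma clopen_agree_closed gamma (V : set X) :
  (forall x y : X, agree gamma (val x) (val y) -> V x -> V y) -> clopen V.
Proof.
move=> Vagree; split; first exact: open_agree_closed Vagree.
rewrite -openC; apply: (open_agree_closed (gamma := gamma)) => x y /agree_sym xy.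
by apply: contra_not; exact: Vagree.
Qed.

Lemma open_bigcup_clopen (k0 : K) (U : set X) : open U ->
  exists2 F : K -> set X, forall k, clopen (F k) & U = \bigcup_k F k.
Proof.
move=> [V oV <-].
exists (fun k => [set x | forall y : X, agree k (val x) (val y) -> V (val y)]) => [k|].
  apply: (@clopen_agree_closed k) => x y xy Fx z yz.
  by apply: Fx; exact: agree_trans xy yz.
apply/seteqP; split=> [x Vx|x [k _ Fx]]; last by apply: Fx.
have [gamma xV] := agree_open k0 oV Vx.
by exists gamma => // y /xV.
Qed.

End bounded_topology.

(** * The Borel hierarchy *)

Lemma ole0 a : ole ozero a.
Proof. by apply/oleE. Qed.

Lemma olt_ozero a : ~ olt a ozero.
Proof. by case. Qed.

Lemma olt_osucc a b : olt a (osucc b) <-> ole a b.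
Proof. by split=> [[]|ab]; last exists tt. Qed.

Lemma olt_irr a : ~ olt a a.
Proof. by elim/(well_founded_ind olt_wf): a => b IH bb; exact: (IH b). Qed.

Section hierarchy.
Context (K : Type) (X : topologicalType).
Implicit Types (A : set X) (a b : ord).

(** This is the topological input on [X]: it makes a Sigma_1 set a kappa-union of Pi_0 sets, so that
    level 1 follows the pattern of the higher levels. *)
Definition open_bigcup_of_clopens := forall U : set X, open U ->
  exists2 F : K -> set X, forall k, clopen (F k) & U = \bigcup_k F k.

Lemma Pi0_Sigma0C a A : Pi0 K a A <-> Sigma0 K a (~` A).
Proof. by split=> [[]|]; last exact: Pi0_setC. Qed.

Lemma Sigma0_Pi0C a A : Sigma0 K a A <-> Pi0 K a (~` A).
Proof. by rewrite Pi0_Sigma0C setCK. Qed.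

Lemma Sigma0_zero a A : ole a ozero -> Sigma0 K a A <-> clopen A.
Proof.
move=> a0; split=> [SA|cA]; last by apply: Sigma0_clopen => //; split=> //; exact: ole0.
case: SA a0 => {a A} [a A _ //|a A [_ /olt_succ a1] _|a b F /olt_succ a1 _ _ _] a0.
  by case/olt_ozero: (olt_le_trans a1 a0).
by case/olt_ozero: (olt_le_trans a1 a0).
Qed.

Lemma Pi0_zero a A : ole a ozero -> Pi0 K a A <-> clopen A.
Proof.
by move=> a0; rewrite Pi0_Sigma0C Sigma0_zero//; split=> /clopenC; rewrite ?setCK; exact.
Qed.

(** A form of [Sigma0_bigcup] uniform in [a]. If [a] is 0 there is no index and the union is empty;
    if [a] is 1 all pieces are clopen and the union is open; from 2 on the family is adapted to the
    constructor. *)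
Lemma Sigma0_bigcup_lt (J : Type) (r : J -> ord) (G : J -> set X) a :
    [set: J] #<= [set: K] -> (forall i, olt (r i) a) ->
    (forall i, Pi0 K (r i) (G i)) ->
  Sigma0 K a (\bigcup_i G i).
Proof.
move=> JK ra PG; have [a0|/olt_succ a1] := ole_total a ozero.
  apply/Sigma0_zero => //; suff -> : \bigcup_i G i = set0 by exact: clopen0.
  by apply/seteqP; split=> // x [i _ _]; case: (olt_ozero (olt_le_trans (ra i) a0)).
have [a1'|/olt_succ a2] := ole_total a oone.
  apply: Sigma0_open; first by split.
  apply: bigcup_open => i _.
  have ri0 : ole (r i) ozero by apply/olt_osucc; exact: olt_le_trans (ra i) a1'.
  by have /(Pi0_zero _ ri0)[] := PG i.
have [f finj] : exists f : J -> K, injective f.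
  have /card_leP/injfunPex[f _ finj] := JK.
  exists (fun i => val (f (SigSub (mem_set (I : [set: J] i))))).
  by move=> i j /val_inj/finj; rewrite !inE => /(_ I I) [].
(* [Sigma0_bigcup] demands pieces of level at least 1, so clopen pieces are promoted to Pi_1. *)
have Pi0_one A b : ole b ozero -> Pi0 K b A -> Pi0 K oone A.
  move=> b0 /(Pi0_zero _ b0)[oA cA]; apply/Pi0_Sigma0C; apply: Sigma0_open.
    by split; exact: ole_refl.
  by rewrite openC.
(* The family is reindexed by [K] along [f], with the empty set off the range of [f]. *)
pose H k := [set x | exists2 i, f i = k & G i x].
have /choice[b /all_and3[b1 ba PH]] k : exists b, [/\ ole oone b, olt b a & Pi0 K b (H k)].
  have [[i fi]|nfi] := pselect (exists i, f i = k).
    have -> : H k = G i.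
      by apply/seteqP; split=> [x [j]|x Gx]; [rewrite -fi => /finj ->|exists i].
    have [ri0|/olt_succ ri1] := ole_total (r i) ozero; last by exists (r i).
    exists oone; split; [exact: ole_refl|exact/olt_succ|exact: Pi0_one ri0 _].
  exists oone; split; [exact: ole_refl|exact/olt_succ|].
  have -> : H k = set0.
    by apply/seteqP; split=> // x [j fj]; case: nfi; exists j.
  by apply: (Pi0_one _ ozero (ole_refl _)); apply/Pi0_zero; [exact: ole_refl|exact: clopen0].
suff -> : \bigcup_i G i = \bigcup_k H k by exact: Sigma0_bigcup b1 ba PH.
apply/seteqP; split=> [x [i _ Gx]|x [k _ [i _ Gx]]]; last by exists i.
by exists (f i) => //; exists i.
Qed.

Lemma Sigma0_decomp a A : open_bigcup_of_clopens -> Sigma0 K a A -> ~ ole a ozero ->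
  exists (r : K -> ord) (F : K -> set X),
    [/\ A = \bigcup_k F k, forall k, olt (r k) a & forall k, Pi0 K (r k) (F k)].
Proof.
move=> og [{}a {}A [] //|{}a {}A [_ a1] oA|{}a b F _ _ ba PF] _; last by exists b, F.
have [F cF ->] := og _ oA; exists (fun=> ozero), F; split=> // k.
  exact/olt_succ.
by apply/Pi0_zero; [exact: ole_refl|exact: cF].
Qed.

(** Pieces of level below [a] are also of level below [b]. A set of level 0 has no such
    decomposition in general and is instead written as a constant union over the nonempty [K]. *)
Lemma Sigma0_le a b A : open_bigcup_of_clopens -> [set: K] !=set0 -> ole a b ->
  Sigma0 K a A -> Sigma0 K b A.
Proof.
move=> og [k0 _] ab SA; have [a0|/olt_succ a1] := ole_total a ozero.
  have cA := (Sigma0_zero _ a0).1 SA.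
  have [b0|b1] := ole_total b ozero; first exact/Sigma0_zero.
  rewrite -[A](bigcup_const (I := K) (P := setT)); last by exists k0.
  apply: (@Sigma0_bigcup_lt _ (fun=> ozero)) => // _.
  by apply/Pi0_zero => //; exact: ole_refl.
have [|r [F [-> ra PF]]] := Sigma0_decomp og SA.
  by move=> a0; exact: (olt_irr (olt_le_trans ((olt_succ _ _).2 a1) a0)).
by apply: Sigma0_bigcup_lt PF => // k; exact: olt_le_trans (ra k) ab.
Qed.

End hierarchy.

(** * Trees and games *)

Section trees.
Variable T : tree.
Implicit Types p q : T.

Lemma immediate_succ_leaf p q : immediate_succ p q -> ~ leaf p.
Proof. by move=> [pq _]; apply; exists q. Qed.

Lemma rank_lt (wfT : wf_tree T) p q : p < q -> olt (rank wfT q) (rank wfT p).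
Proof.
move=> pq; rewrite (rankE wfT p).
exact: (ole_osup (fun q : {q | p < q} => rank wfT (sval q)) (exist _ q pq)).
Qed.

Lemma rank_leaf (wfT : wf_tree T) p : leaf p -> ole (rank wfT p) ozero.
Proof. by move=> lp; rewrite rankE; apply/oleE => -[q pq]; case: lp; exists q. Qed.

Variable r : T -> ord.
Hypothesis rlt : forall p q, p < q -> olt (r q) (r p).

(* The element of a chain with the least value of [r] is its maximum, and it
   has finitely many predecessors. *)
Lemma ranked_wf_tree : wf_tree T.
Proof.
move=> [C [Cinf Ctot]].
have [m Cm mmax] : exists2 m, C m & forall q, C q -> ~ m < q.
  have [p Cp] := infinite_setN0 Cinf.
  have [a pa] : exists a, a = r p by exists (r p).
  elim/(well_founded_ind olt_wf): a p Cp pa => a IH p Cp pa.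
  have [[q [Cq pq]]|nq] := pselect (exists q, C q /\ p < q).
    by apply: (IH (r q)) Cq erefl; rewrite pa; exact: rlt.
  by exists p => // q Cq pq; apply: nq; exists q.
apply: Cinf; apply: (@sub_finite_set _ _ ([set q | q < m] `|` [set m])).
  move=> q Cq; have [qm|] := Ctot q m Cq Cm.
    by move: qm; rewrite le_eqVlt => /orP[/eqP->|]; [right|left].
  by rewrite le_eqVlt => /orP[/eqP->|/(mmax _ Cq)//]; right.
by rewrite finite_setU; split; [exact: preds_finite|exact: finite_set1].
Qed.

(** Among the ordinal functions that drop strictly along the tree order, [rank] is the least. *)
Lemma rank_le (wfT : wf_tree T) p : ole (rank wfT p) (r p).
Proof.
elim/(well_founded_ind (wf_tree_gt wfT)): p => p IH.
rewrite rankE; apply/oleE => -[q pq] /=.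
exact: ole_lt_trans (IH _ pq) (rlt pq).
Qed.

End trees.

Section game_value.
Context (K : Type) (X : topologicalType) (c : borel_code K X).
Implicit Types (x : X) (p q : c).

(* [wins x b p]: player II wins from [p], with II to move iff [b] *)
Inductive wins x : bool -> c -> Prop :=
| wins_leaf b p : leaf p -> label p x -> wins x b p
| wins_I p : ~ leaf p -> (forall q, immediate_succ p q -> wins x true q) ->
    wins x false p
| wins_II p q : immediate_succ p q -> wins x false q -> wins x true p.

Lemma wins_leafE x b p : leaf p -> wins x b p <-> label p x.
Proof.
move=> lp; split; last exact: wins_leaf.
by move=> w; case: w lp => // {}p q /immediate_succ_leaf.
Qed.

Lemma wins_IE x p : ~ leaf p ->
  wins x false p <-> forall q, immediate_succ p q -> wins x true q.
Proof.
move=> nlp; split; last exact: wins_I.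
suff H b : wins x b p -> b = false -> forall q, immediate_succ p q -> wins x true q.
  by move=> /H; exact.
by move=> w; case: w nlp.
Qed.

Lemma wins_IIE x p : ~ leaf p ->
  wins x true p <-> exists2 q, immediate_succ p q & wins x false q.
Proof.
move=> nlp; split; last by move=> [q]; exact: wins_II.
suff H b : wins x b p -> b = true -> exists2 q, immediate_succ p q & wins x false q.
  by move=> /H; exact.
by move=> w; case: w nlp => // {}p q pq wq _ _; exists q.
Qed.

Lemma position_rcons s q :
  position (rcons s q) <-> position s /\ immediate_succ (last (root c) s) q.
Proof. by rewrite /position rcons_path; split=> [/andP[-> /asboolP]|[-> /asboolP]]. Qed.

Lemma follows_rcons (sigma : seq c -> c) s q :
  follows sigma (rcons s q) <->
  follows sigma s /\ (odd (size s) -> q = sigma s).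
Proof.
split=> [fs|[fs sq] i].
  split=> [i si oi|os].
    have := fs i; rewrite size_rcons ltnS (ltnW si) nth_rcons si => /(_ isT oi) ->.
    by rewrite -cats1 take_cat si.
  have := fs (size s); rewrite size_rcons ltnSn nth_rcons ltnn eqxx => /(_ isT os) ->.
  by rewrite -cats1 take_size_cat.
rewrite size_rcons ltnS leq_eqVlt => /orP[/eqP-> os|si oi].
  by rewrite nth_rcons ltnn eqxx -cats1 take_size_cat// sq.
by rewrite nth_rcons si -cats1 take_cat si; exact: fs.
Qed.

(** A strategy yields [wins] by well-founded induction on the node reached. Conversely, choosing a
    winning successor at each node won by II gives a strategy that looks only at the current
    node. *)
Lemma borel_setE : borel_set c = [set x | wins x false (root c)].
Proof.
apply/seteqP; split=> x /=.
  move=> [sigma win].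
  (* [sigma] may depend on the whole history, so the induction on [p] ranges over all plays [s]
     reaching [p]; the parity of [s] tells who is to move. *)
  suff H p s : last (root c) s = p -> position s -> follows sigma s ->
      wins x (odd (size s)) p.
    exact: (H _ [::]).
  elim/(well_founded_ind (wf_tree_gt (code_wf c))): p s => p IH s sp ps fs.
  have [wl wII] := win s ps fs; rewrite sp in wl wII.
  have [lp|nlp] := pselect (leaf p); first by apply: wins_leaf => //; exact: wl.
  have step q : immediate_succ p q -> (odd (size s) -> q = sigma s) ->
      wins x (~~ odd (size s)) q.
    move=> pq sq; have := IH q pq.1 (rcons s q); rewrite last_rcons size_rcons; apply=> //.
      by apply/position_rcons; rewrite sp.
    exact/follows_rcons.
  case: (odd (size s)) wII step => [wII|_] step.
    apply: (wins_II (q := sigma s)); first exact: wII.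
    by apply: step => //; exact: wII.
  by apply: wins_I => // q pq; exact: step.
move=> wroot.
have /choice[f fP] p : exists q, wins x true p -> ~ leaf p ->
    immediate_succ p q /\ wins x false q.
  have [[w nlp]|n] := pselect (wins x true p /\ ~ leaf p).
    by have [q] := (wins_IIE _ nlp).1 w; exists q.
  by exists p => w nlp; case: n.
exists (fun s => f (last (root c) s)) => s ps fs.
(* Invariant: every play that follows the strategy stays at nodes won by II. *)
have w : wins x (odd (size s)) (last (root c) s).
  elim/last_ind: s ps fs => [//|s q IH] /position_rcons[ps sq] /follows_rcons[fs fq].
  rewrite last_rcons size_rcons /=; have nls := immediate_succ_leaf sq.
  case: (odd (size s)) fq (IH ps fs) => [->//|_] w.
    by have [] := fP _ w nls.
  exact: (wins_IE _ nls).1 w _ sq.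
split=> [ls|os nls]; first exact: (wins_leafE _ _ ls).1 w.
by rewrite os in w; have [] := fP _ w nls.
Qed.

(** The two claims are proved together because a move passes the turn to the other player. At a leaf
    both classes consist of the clopen sets. *)
Lemma wins_complexity p :
  Pi0 K (rank (code_wf c) p) [set x | wins x false p] /\
  Sigma0 K (rank (code_wf c) p) [set x | wins x true p].
Proof.
elim/(well_founded_ind (wf_tree_gt (code_wf c))): p => p IH.
have [lp|nlp] := pselect (leaf p).
  have r0 := rank_leaf (code_wf c) lp.
  have E b : [set x | wins x b p] = label p.
    by apply/seteqP; split=> x /=; rewrite wins_leafE.
  by rewrite !E; split; [apply/Pi0_zero|apply/Sigma0_zero] => //; exact: label_clopen.
pose J := {q | immediate_succ p q}.
have JK : [set: J] #<= [set: K].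
  apply: card_le_trans (code_card c).
  apply: (@card_le_rel _ _ (fun (j : J) q => sval j = q)) => [j _|].
    by exists (sval j).
  by move=> [q pq] [q' pq'] _ /= <- q'q; exact: eq_exist.
have Sigma_union (G : c -> set X) :
    (forall q, immediate_succ p q -> Pi0 K (rank (code_wf c) q) (G q)) ->
    Sigma0 K (rank (code_wf c) p) (\bigcup_(j : J) G (sval j)).
  move=> PG.
  apply: (Sigma0_bigcup_lt (r := fun j : J => rank (code_wf c) (sval j)) JK) => -[q pq] /=.
    exact: rank_lt pq.1.
  exact: PG.
split.
  rewrite Pi0_Sigma0C.
  have -> : ~` [set x | wins x false p] = \bigcup_(j : J) ~` [set x | wins x true (sval j)].
    apply/seteqP; split=> [x /=|x [[q pq] _ nw] /= /(wins_IE _ nlp)/(_ _ pq)//].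
    rewrite wins_IE// => /existsNP[q /not_implyP[pq nw]].
    by exists (exist _ q pq).
  apply: (Sigma_union (fun q => ~` [set x | wins x true q])) => q pq.
  by apply/Sigma0_Pi0C; exact: (IH q pq.1).2.
have -> : [set x | wins x true p] = \bigcup_(j : J) [set x | wins x false (sval j)].
  apply/seteqP; split=> [x /= /(wins_IIE _ nlp)[q pq w]|x [[q pq] _ w]].
    by exists (exist _ q pq).
  exact: wins_II pq w.
apply: (Sigma_union (fun q => [set x | wins x false q])) => q pq.
exact: (IH q pq.1).1.
Qed.

End game_value.

(** * From sets to codes *)

Section game_codes.
Context (K : choiceType) (X : topologicalType).

(** An inductive presentation of codes in which every inner node branches over all of [K]: gluing
    codes below a new root is just [GNode], and an order-theoretic tree is extracted only
    afterwards. *)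
Inductive gcode : Type := GLeaf of set X | GNode of (K -> gcode).

Fixpoint clopen_leaves (e : gcode) : Prop :=
  match e with GLeaf A => clopen A | GNode f => forall k, clopen_leaves (f k) end.

Fixpoint grank (e : gcode) : ord :=
  match e with GLeaf _ => ozero | GNode f => osup (fun k => grank (f k)) end.

Fixpoint gcompl (e : gcode) : gcode :=
  match e with GLeaf A => GLeaf (~` A) | GNode f => GNode (fun k => gcompl (f k)) end.

(* [gval b e]: the points for which II wins on [e], with II to move iff [b] *)
Fixpoint gval (b : bool) (e : gcode) : set X :=
  match e with
  | GLeaf A => A
  | GNode f => if b then \bigcup_k gval false (f k) else \bigcap_k gval true (f k)
  end.

Fixpoint subcode (e : gcode) (s : seq K) {struct s} : option gcode :=
  match s, e with
  | [::], _ => Some e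
  | k :: s', GNode f => subcode (f k) s'
  | _ :: _, GLeaf _ => None
  end.

(** By De Morgan, complementing the leaves amounts to exchanging the players. *)
Lemma gval_compl b e : gval b (gcompl e) = ~` gval (~~ b) e.
Proof.
elim: e b => [//|f IH] [] /=.
  by rewrite setC_bigcap; apply: eq_bigcupr => k _; rewrite IH.
by rewrite setC_bigcup; apply: eq_bigcapr => k _; rewrite IH.
Qed.

Lemma grank_compl e : grank (gcompl e) = grank e.
Proof. by elim: e => [//|f IH] /=; congr osup; apply/funext. Qed.

Lemma clopen_leaves_compl e : clopen_leaves e -> clopen_leaves (gcompl e).
Proof. by elim: e => [A /clopenC|f IH /= + k] => [/(_ set0)//|/(_ k)/IH]. Qed.

Lemma subcode_cat e s t : subcode e (s ++ t) = obind (subcode^~ t) (subcode e s).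
Proof. by elim: s e => [|k s IH] [A|f] //=. Qed.

Lemma subcode_catl e s t : subcode e (s ++ t) -> subcode e s.
Proof. by rewrite subcode_cat; case: subcode. Qed.

Lemma clopen_subcode e s e' :
  subcode e s = Some e' -> clopen_leaves e -> clopen_leaves e'.
Proof. by elim: s e => [e [<-]//|k s IH] [//|f] /= /IH + cf; exact. Qed.

Lemma grank_subcode e s e' : subcode e s = Some e' -> ole (grank e') (grank e).
Proof.
elim: s e => [e [<-]|k s IH [//|f] /= /IH fk]; first exact: ole_refl.
exact/oltW/(ole_lt_trans fk)/(ole_osup (fun k => grank (f k)) k).
Qed.

Lemma grank_subcode_lt e k s e' :
  subcode e (k :: s) = Some e' -> olt (grank e') (grank e).
Proof.
case: e => [//|f] /= /grank_subcode fk.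
exact: ole_lt_trans fk (ole_osup (fun k => grank (f k)) k).
Qed.

Variable e : gcode.

(** Nodes are paths rather than subcodes, so equal subcodes at different places stay distinct. *)
Definition gnode : Type := {s : seq K | isSome (subcode e s)}.

Definition gnode_of s (es : isSome (subcode e s)) : gnode := exist _ s es.

HB.instance Definition _ := Choice.on gnode.

Definition gnode_le (p q : gnode) : bool := prefix (val p) (val q).

Lemma gnode_le_refl : reflexive gnode_le.
Proof. by move=> p; exact: prefix_refl. Qed.

Lemma gnode_le_anti : antisymmetric gnode_le.
Proof.
move=> p q /andP[pq qp]; apply: val_inj; move: (pq); rewrite /gnode_le prefixE.
have -> : size (val p) = size (val q).
  by apply/eqP; rewrite eqn_leq (size_prefix pq) (size_prefix qp).
by rewrite take_size => /eqP ->.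
Qed.

Lemma gnode_le_trans : transitive gnode_le.
Proof. by move=> p q r; exact: prefix_trans. Qed.

Fact gnode_display : Order.disp_t. Proof. exact: Order.Disp tt tt. Qed.

HB.instance Definition _ := Order.Le_isPOrder.Build gnode_display gnode
  gnode_le_refl gnode_le_anti gnode_le_trans.

Lemma gnode_ltP (p q : gnode) :
  p < q <-> exists k s, val q = val p ++ k :: s.
Proof.
rewrite lt_neqAle; split=> [/andP[pq /prefixP[[|k s] qp]]|[k [s qp]]].
- by case/eqP: pq; apply: val_inj; rewrite qp cats0.
- by exists k, s.
- apply/andP; split; last by apply/prefixP; exists (k :: s).
  apply/eqP => pq; have := congr1 size qp.
  by rewrite pq size_cat /= -[LHS]addn0 => /eqP; rewrite eqn_add2l.
Qed.

Definition gnode_root : gnode := @gnode_of [::] isT.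

Lemma gnode_root_le (p : gnode) : gnode_root <= p.
Proof. exact: prefix0s. Qed.

Lemma gnode_root_min (p : gnode) : ~ p < gnode_root.
Proof. by move=> /(le_lt_trans (gnode_root_le p)); rewrite ltxx. Qed.

Lemma gnode_root_unique (m : gnode) : (forall p : gnode, ~ p < m) -> m = gnode_root.
Proof.
move=> /(_ gnode_root); have := gnode_root_le m.
by rewrite le_eqVlt => /orP[/eqP|].
Qed.

Lemma gnode_preds_finite (p : gnode) : finite_set [set q : gnode | q < p].
Proof.
(* The predecessors of [p] are among the truncations of its sequence. *)
have fin : finite_set [set` [seq take i (val p) | i <- iota 0 (size (val p)).+1]].
  exact: finite_seq.
apply: sub_finite_set (finite_preimage (f := val) _ fin).
  move=> q /ltW qp; apply/mapP; exists (size (val q)).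
    by rewrite mem_iota /= add0n ltnS size_prefix.
  by apply/esym/eqP; rewrite -prefixE.
by move=> q r _ _; exact: val_inj.
Qed.

Lemma gnode_preds_linear (p : gnode) :
  total_on [set q : gnode | q < p] (fun q r => q <= r).
Proof.
suff H (q r : gnode) : q < p -> r < p ->
    (size (val q) <= size (val r))%N -> q <= r.
  by move=> q r qp rp; have /orP[] := leq_total (size (val q)) (size (val r));
    [left|right]; exact: H.
move=> /ltW + /ltW; rewrite /Order.le/= /gnode_le !prefixE => /eqP qp /eqP rp qr.
by rewrite -rp take_takel// qp.
Qed.

Definition gtree : tree := Tree gnode_root_min gnode_root_unique
  gnode_preds_finite gnode_preds_linear.

(** The strictly decreasing function that witnesses well-foundedness and bounds the rank. The
    default [ozero] never occurs, as [subcode] is defined at every node. *)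
Definition gnode_rank (p : gtree) : ord := oapp grank ozero (subcode e (val p)).

Lemma gnode_rank_lt (p q : gtree) : p < q -> olt (gnode_rank q) (gnode_rank p).
Proof.
move=> /gnode_ltP[k [s qp]]; rewrite /gnode_rank.
have := subcode_cat e (val p) (k :: s); rewrite -qp.
have := valP q; case: (subcode e (val q)) => [e2|//] _.
by case: (subcode e (val p)) => [e1|//] /esym/grank_subcode_lt.
Qed.

Lemma gtree_immediate_succP (p q : gtree) :
  immediate_succ p q <-> exists k, val q = rcons (val p) k.
Proof.
split=> [[/gnode_ltP[k [s qp]] nbetw]|[k qp]].
  case: s qp => [|l s] qp; first by exists k; rewrite -cats1.
  (* If [q] adds at least two letters to [p], adding only the first gives a node strictly
     between. *)
  exfalso; apply: nbetw; have := valP q; rewrite qp -cat_rcons => /subcode_catl pk.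
  exists (gnode_of pk); split; apply/gnode_ltP; first by exists k, [::]; rewrite cats1.
  by exists l, s; rewrite /= cat_rcons.
split; first by apply/gnode_ltP; exists k, [::]; rewrite cats1.
move=> [r [/gnode_ltP[l [s rp]] /gnode_ltP[m [t qr]]]].
(* A node strictly between would make [q] at least two letters longer than [p]. *)
have := congr1 size qr; rewrite qp rp size_rcons !size_cat /= -addnA.
by rewrite addSn !addnS => /eqP; rewrite eqSS ltn_eqF// ltnS leq_addr.
Qed.

Lemma gtree_leaf (p : gtree) A : subcode e (val p) = Some (GLeaf A) -> leaf p.
Proof.
move=> pA [q /gnode_ltP[k [s qp]]].
by have := valP q; rewrite qp subcode_cat pA.
Qed.

Lemma gtree_succ (p : gtree) f k : subcode e (val p) = Some (GNode f) ->
  exists2 q : gtree, immediate_succ p q & subcode e (val q) = Some (f k).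
Proof.
move=> pf; have qk : subcode e (rcons (val p) k) = Some (f k).
  by rewrite -cats1 subcode_cat pf.
have qS : isSome (subcode e (rcons (val p) k)) by rewrite qk.
by exists (gnode_of qS) => //; apply/gtree_immediate_succP; exists k.
Qed.

Lemma gtree_succ_inv (p q : gtree) f : subcode e (val p) = Some (GNode f) ->
  immediate_succ p q -> exists k, subcode e (val q) = Some (f k).
Proof.
move=> pf /gtree_immediate_succP[k ->]; exists k.
by rewrite -cats1 subcode_cat pf.
Qed.

Definition glabel (p : gtree) : set X :=
  if subcode e (val p) is Some (GLeaf A) then A else set0.

Hypothesis K0 : [set: K] !=set0.

(** As [K] is nonempty, a [GNode] has successors, so leaves of the tree carry a [GLeaf]. *)
Lemma glabel_clopen : clopen_leaves e -> forall p, leaf p -> clopen (glabel p).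
Proof.
move=> ce p lp; rewrite /glabel; case E: subcode => [[A|f]|].
- exact: (clopen_subcode E ce).
- have [k _] := K0; have [q /immediate_succ_leaf//] := gtree_succ k E.
- exact: clopen0.
Qed.

End game_codes.

Lemma gtree_card (K : choiceType) (X : topologicalType) (e : gcode K X) :
  infinite_set [set: K] -> [set: gtree e] #<= [set: K].
Proof.
move=> Kinf; have [k0 _] := infinite_setN0 Kinf.
pose Kp : pointedType := HB.pack (Choice.sort K) (isPointed.Build (Choice.sort K) k0).
apply: card_le_trans (@infinite_card_seq Kp Kinf).
apply: (@card_le_rel _ _ (fun (p : gtree e) s => val p = s)) => [p _|p q s <- /val_inj ->//].
by exists (val p).
Qed.

Section gtree_code.
Context (K : choiceType) (X : topologicalType) (Kinf : infinite_set [set: K]).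
Context (e : gcode K X) (ce : clopen_leaves e).

Definition gtree_code : borel_code K X :=
  BorelCode (ranked_wf_tree (@gnode_rank_lt K X e)) (gtree_card e Kinf)
    (glabel_clopen (infinite_setN0 Kinf) ce).

Lemma wins_gval x b (p : gtree_code) e' : subcode e (val p) = Some e' ->
  wins (c := gtree_code) x b p <-> gval b e' x.
Proof.
elim: e' b p => [A|f IH] b p pe.
  by rewrite (wins_leafE (c := gtree_code) _ _ (gtree_leaf pe)) /= /glabel pe.
have nlp : ~ leaf p.
  have [k _] := infinite_setN0 Kinf.
  by have [q /immediate_succ_leaf] := gtree_succ k pe.
case: b => /=.
  rewrite (wins_IIE (c := gtree_code) _ nlp); split.
    by move=> [q pq wq]; have [k qk] := gtree_succ_inv pe pq; exists k => //; exact: (IH k _ q qk).1 wq.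
  move=> [k _ vk]; have [q pq qk] := gtree_succ k pe.
  by exists q => //; exact: (IH k _ q qk).2 vk.
rewrite (wins_IE (c := gtree_code) _ nlp); split.
  move=> w k _; have [q pq qk] := gtree_succ k pe.
  exact: (IH k _ q qk).1 (w q pq).
by move=> v q pq; have [k qk] := gtree_succ_inv pe pq; exact: (IH k _ q qk).2 (v k I).
Qed.

Lemma borel_set_gtree : borel_set gtree_code = gval false e.
Proof.
by rewrite borel_setE; apply/seteqP; split=> x /wins_gval; exact.
Qed.

Lemma tree_rank_gtree a : ole (grank e) a ->
  ole (tree_rank (code_wf gtree_code)) (osucc a).
Proof.
move=> ea; apply/olt_succ/olt_osucc/(ole_trans _ ea).
exact: (rank_le (@gnode_rank_lt K X e)).
Qed.

End gtree_code.

(** Below the new root, where II picks [k], player I is to move. The induction hypothesis codes the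
    complement of [F k] with II to move, and [gcompl] turns this into a code of [F k] with I to
    move. *)
Lemma Sigma0_gcode (K : choiceType) (X : topologicalType) a (A : set X) :
  open_bigcup_of_clopens K X -> Sigma0 K a A ->
  exists e : gcode K X, [/\ clopen_leaves e, ole (grank e) a & gval true e = A].
Proof.
move=> og; elim/(well_founded_ind olt_wf): a A => a IH A SA.
have [a0|a1] := pselect (ole a ozero).
  exists (GLeaf K A); split=> //=; last exact: ole0.
  exact: (Sigma0_zero K A a0).1 SA.
have [r [F [-> ra PF]]] := Sigma0_decomp og SA a1.
have /choice[e /all_and3[ce re ve]] k : exists e : gcode K X,
    [/\ clopen_leaves e, ole (grank e) (r k) & gval true e = ~` F k].
  by apply: (IH _ (ra k)); rewrite -Pi0_Sigma0C.
exists (GNode (fun k => gcompl (e k))); split=> /=.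
- by move=> k; exact: clopen_leaves_compl.
- by apply/oleE => k; rewrite grank_compl; exact: ole_lt_trans (re k) (ra k).
- by apply: eq_bigcupr => k _; rewrite gval_compl ve setCK.
Qed.

Theorem theorem2p5 (d : Order.disp_t) (K : orderType d)
    (hK : infinite_cardinal K) (X : set (bspace K)) (alpha : ord)
    (halpha : below_succ_card K alpha) (A : set X) :
  Pi0 K alpha A <->
  exists c : borel_code K X,
    ole (tree_rank (code_wf c)) (osucc alpha) /\ A = borel_set c.
Proof.
have [_ Kinf _] := hK.
have K0 := infinite_setN0 Kinf.
have og : open_bigcup_of_clopens K X.
  by have [k0 _] := K0; move=> U; exact: open_bigcup_clopen.
split=> [/Pi0_Sigma0C/(Sigma0_gcode og)[e [ce re ve]]|[c [/olt_succ/olt_osucc rc ->]]].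
  (* [e] codes the complement of [A] with II moving first; its complement codes [A] with I moving
     first, as the game requires. *)
  exists (gtree_code Kinf (clopen_leaves_compl ce)); split.
    by apply: tree_rank_gtree; rewrite grank_compl.
  by rewrite borel_set_gtree gval_compl ve setCK.
(* After cancelling successors, the rank of the root is at most [alpha], and monotonicity raises the
   level from that rank to [alpha]. *)
rewrite borel_setE Pi0_Sigma0C; apply: Sigma0_le rc _ => //.
by rewrite -Pi0_Sigma0C; exact: (wins_complexity _).1.
Qed.
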